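(* For every graph $H$ with at least one edge and each $\eta>0$ there exists an integer $n_0=n_0(H,\eta)$ such that if $G$ is a graph on $n\ge n_0$ vertices and $$d(x)+d(y)\ge 2\left(1-\frac{1}{\chi_{cr}(H)}\right)n$$ for all non-adjacent $x\ne y\in V(G)$, then $G$ has an $H$-packing covering all but at most $\eta n$ vertices of $G$.
   Context: All graphs are finite and simple; $|H|$ is the number of vertices of $H$ and $d(x)$ the degree of $x$. An $H$-packing in $G$ is a collection of vertex-disjoint copies of $H$ in $G$ (as not necessarily induced subgraphs). Let $\sigma(H)$ be the smallest possible size of a colour class in any proper $\chi(H)$-colouring of $H$; the critical chromatic number is $\chi_{cr}(H):=(\chi(H)-1)\frac{|H|}{|H|-\sigma(H)}$. *)

(* Defs.v *)
From mathcomp Require Import all_boot all_order all_algebra.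
From mathcomp Require Import reals.

Set Implicit Arguments.
Unset Strict Implicit.
Unset Printing Implicit Defensive.

Import Order.TTheory GRing.Theory Num.Theory.

Record sgraph := SGraph {
  vertex :> finType;
  adj : rel vertex;
  adj_sym : symmetric adj;
  adj_irr : irreflexive adj }.

Definition degree (G : sgraph) (x : G) : nat := #|[set y | adj x y]|.

Definition proper_colouring (G : sgraph) (k : nat) (c : {ffun G -> 'I_k}) : bool :=
  [forall x, forall y, adj x y ==> (c x != c y)].

Definition colourable (G : sgraph) (k : nat) : bool :=
  [exists c : {ffun G -> 'I_k}, proper_colouring c].

Lemma colourable_exists (G : sgraph) : exists k, colourable G k.
Proof.
exists #|G|; apply/existsP; exists [ffun x => enum_rank x].
apply/forallP => x; apply/forallP => y; apply/implyP => xy.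
rewrite !ffunE (inj_eq enum_rank_inj).
by apply: contraTneq xy => ->; rewrite adj_irr.
Qed.

Definition chi (G : sgraph) : nat := ex_minn (colourable_exists G).

Definition colour_class (G : sgraph) (k : nat) (c : {ffun G -> 'I_k}) (i : 'I_k) : {set G} :=
  [set x | c x == i].

(* The default value #|G| of the minimum is harmless: a proper colouring with
   [chi G] colours exists, every colour class has at most #|G| vertices, and
   there is no colour at all only when G is empty. *)
Definition sigma (G : sgraph) : nat :=
  \big[Order.min/#|G|]_(c : {ffun G -> 'I_(chi G)} | proper_colouring c)
    \big[Order.min/#|G|]_(i < chi G) #|colour_class c i|.

Local Open Scope ring_scope.

Definition chi_cr (R : realType) (G : sgraph) : R :=
  ((chi G)%:R - 1) * (#|G|%:R / (#|G|%:R - (sigma G)%:R)).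

(* A copy of H in G, not necessarily induced, is given by an injective
   adjacency-preserving map from H to G. *)
Definition embedding (H G : sgraph) (f : {ffun H -> G}) : Prop :=
  injective f /\ forall u v : H, adj u v -> adj (f u) (f v).

Definition copy_vertices (H G : sgraph) (f : {ffun H -> G}) : {set G} :=
  [set f u | u in [set: H]].

(* If H is non-empty, two distinct embeddings with the same image are not
   vertex-disjoint, so a packing contains at most one embedding per copy. *)
Definition packing (H G : sgraph) (P : {set {ffun H -> G}}) : Prop :=
  (forall f, f \in P -> embedding f) /\
  (forall f g, f \in P -> g \in P -> f != g ->
     [disjoint copy_vertices f & copy_vertices g]).

Definition covered (H G : sgraph) (P : {set {ffun H -> G}}) : {set G} :=
  \bigcup_(f in P) copy_vertices f.

(* Main.v *)
(* The regularity method is not needed. Write b = |H| and r = chi(H), and let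
   1/chi_cr(H) = theta.

   Cheap copies. Let L be a set of m vertices inducing a graph with the Ore
   condition, with a little slack, and let w be a weight on L. Order L by
   weight and let q_j be the weight at position j * theta * m, for
   0 <= j < r. An argument in the style of Erdos and Stone finds a large
   complete r-partite graph whose class j has weights at most q_j: a vertex of
   codegree at most theta * m excludes at most theta * m candidates for the
   later classes, and the vertices of larger codegree form a clique, which is
   even better. Placing the smallest colour class of H into the heaviest class
   and rotating the others gives a copy of H of average weight at most the
   average of w over L, up to a small error.

   Iteration. Remove copies of H one at a time, choosing w such that a cheap
   copy keeps the relative degrees d_L(x)/|L| close to d(x)/n for most x; the
   Ore condition with slack then persists until few vertices are left. Slack is
   gained beforehand by adding a few vertices adjacent to everything. *)
Require Import Defs.
From mathcomp Require Import all_boot all_order all_algebra.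
From mathcomp Require Import perm reals ring lra zify.
Import Order.TTheory GRing.Theory Num.Theory.

Set Implicit Arguments.
Unset Strict Implicit.
Unset Printing Implicit Defensive.

(** * Complete multipartite subgraphs *)

Definition nbhd (G : sgraph) (x : G) : {set G} := [set y | adj x y].

Lemma in_nbhd (G : sgraph) (x y : G) : (y \in nbhd x) = adj x y.
Proof. by rewrite inE. Qed.

Definition take_set (T : finType) (k : nat) (A : {set T}) : {set T} :=
  [set x in take k (enum A)].

Lemma take_set_sub (T : finType) k (A : {set T}) : take_set k A \subset A.
Proof.
by apply/subsetP => x; rewrite inE => /mem_take; rewrite mem_enum.
Qed.

Lemma card_take_set (T : finType) k (A : {set T}) :
  k <= #|A| -> #|take_set k A| = k.
Proof.
move=> kA; rewrite cardsE (card_uniqP _) ?take_uniq ?enum_uniq //.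
by rewrite size_takel // -cardE.
Qed.

Lemma pigeonhole (T S : finType) (f : T -> S) (Y : {set T}) (C : {set S}) k :
  (forall x, x \in Y -> f x \in C) -> #|C| * k < #|Y| ->
  exists2 s, s \in C & k < #|[set x in Y | f x == s]|.
Proof.
move=> fC; rewrite ltnNge => kY; apply/exists_inP; apply: contraR kY.
rewrite negb_exists_in => /forall_inP small.
rewrite -sum1_card (partition_big f (mem C)) //= -sum_nat_const.
apply: leq_sum => s sC; move: (small s sC); rewrite -leqNgt.
by rewrite -sum1_card; under eq_bigl do rewrite inE.
Qed.

Lemma card_bigcup_leq (T : finType) (j M : nat) (F : nat -> {set T}) :
  (forall i, i < j -> #|F i| <= M) -> #|\bigcup_(i < j) F i| <= j * M.
Proof.
elim: j => [|j IH] FM; first by rewrite big_ord0 cards0.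
rewrite big_ord_recr /= mulSnr (leq_trans (leq_card_setU _ _)) //.
by apply: leq_add; [apply: IH => i ij; apply: FM; lia | apply: FM].
Qed.

(** Double counting of the non-adjacent pairs between [L] and [T]: each vertex of [T] lies in at
    most (1 - 1/p) Z of them, each low-degree vertex of [L] in more than (p - 1) t. *)
Lemma few_low_degree (G : sgraph) (L T : {set G}) (p t Z : nat) :
  0 < p -> #|T| = p * t ->
  (forall v, v \in T -> p * #|L :\: nbhd v| <= p.-1 * Z) ->
  #|[set x in L | #|T :&: nbhd x| < t]| <= Z.
Proof.
move=> p0 Tpt small; set Bd := [set x in L | _].
have count : \sum_(x in L) #|T :\: nbhd x| = \sum_(v in T) #|L :\: nbhd v|.
  under eq_bigr => x _ do rewrite -sum1_card.
  under [RHS]eq_bigr => x _ do rewrite -sum1_card.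
  rewrite (exchange_big_dep (mem T)) /=; last by move=> x v _; rewrite inE => /andP[].
  apply: eq_bigr => v vT; apply: eq_bigl => x.
  by rewrite !inE vT andbT adj_sym andbC.
have up : p * (\sum_(v in T) #|L :\: nbhd v|) <= p * (t * (p.-1 * Z)).
  rewrite big_distrr /= mulnA -Tpt -sum_nat_const.
  exact: leq_sum.
have low : #|Bd| * (p * t - t).+1 <= \sum_(x in L) #|T :\: nbhd x|.
  rewrite -sum_nat_const [leqRHS](big_setID Bd) /=.
  have -> : L :&: Bd = Bd by apply/setIidPr/subsetP => x; rewrite inE => /andP[].
  apply: leq_trans (leq_addr _ _); apply: leq_sum => x.
  rewrite inE => /andP[_]; have := cardsID (nbhd x) T; rewrite Tpt.
  by have := leq_pmull t p0; lia.
rewrite -(leq_pmul2r (ltn0Sn (p * t - t))) (leq_trans low) // count.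
move: up; rewrite leq_pmul2l // => up; apply: leq_trans up _.
rewrite mulnA [leqLHS]mulnC leq_mul2l; apply/orP; right.
by case: p p0 {Tpt small low} => // p _; rewrite /= mulSn addKn mulnC leqnSn.
Qed.

(** A complete [j]-partite graph; irreflexivity of [adj] makes distinct classes disjoint. *)
Definition complete_parts (G : sgraph) (U T : nat -> {set G}) (j t : nat) : Prop :=
  (forall i, i < j -> T i \subset U i /\ #|T i| = t) /\
  (forall i k x y, i < k -> k < j -> x \in T i -> y \in T k -> adj x y).

Lemma split_parts (T : finType) (F : {set T}) (r t : nat) : r * t <= #|F| ->
  exists P : nat -> {set T},
    (forall i, i < r -> P i \subset F /\ #|P i| = t) /\
    (forall i k x y, i < k -> k < r -> x \in P i -> y \in P k -> x != y).
Proof.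
elim: r F => [|r IH] F rF; first by exists (fun=> set0).
have tF : t <= #|F| by move: rF; rewrite mulSn; lia.
have [|P [PF Pdisj]] := IH (F :\: take_set t F).
  rewrite cardsD (setIidPr (take_set_sub _ _)) card_take_set //.
  by move: rF; rewrite mulSn; lia.
exists (fun i => if i is i'.+1 then P i' else take_set t F); split.
  move=> [|i] ir; first by rewrite take_set_sub card_take_set.
  have [PiF ->] := PF i ir; split => //.
  exact: subset_trans PiF (subsetDl _ _).
move=> [|i] [|k] x y // ik kr xP yP; last exact: (Pdisj i k).
have [/subsetP/(_ y yP)] := PF k kr; rewrite inE => /andP[yn _] _.
by apply: contraNneq yn => <-.
Qed.

(* The K_r-blow-up is built one class at a time. Vertices with few neighbours
   in some earlier class number at most [j * Z], and among the others two many
   share their neighbourhood in the earlier classes. If such a group consists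
   of vertices outside [B], it is a clique and supplies all remaining classes
   at once. *)
Lemma complete_parts_exist_upto (p r j t : nat) : 0 < p -> j <= r ->
  exists E, forall (G : sgraph) (L B : {set G}) (U : nat -> {set G}) (Z : nat),
    (forall v, v \in B -> p * #|L :\: nbhd v| <= p.-1 * Z) ->
    (forall i k, i <= k -> U i \subset U k) ->
    (forall i, i < r -> U i \subset L) ->
    (forall i x y, i < r -> x \in U i -> y \in U i ->
       x \notin B -> y \notin B -> x != y -> adj x y) ->
    (forall i, i < r -> i * Z + E <= #|U i|) ->
  (exists T, complete_parts U T r t) \/
  (exists T, complete_parts U T j t /\ forall i, i < j -> T i \subset B).
Proof.
move=> p0; elim: j t => [|j IH] t jr.
  exists 0 => G L B U Z _ _ _ _ _; right; exists (fun=> set0).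
  by split=> //; split.
(* Classes of size [p * t] are requested so that [t] vertices of each survive the passage to a
   common neighbourhood. *)
have [E1 E1P] := IH (p * t) (ltnW jr).
(* Number of types, a type being a trace on the earlier classes together with membership in [B],
   times the r t vertices needed when the group is a clique. *)
exists (E1 + ((2 ^ (j * (p * t)) * 2) * (r * t)).+1).
move=> G L B U Z BZ Umono UL clq Ubig.
have [|[T [TU Tadj]]|[T [[TU Tadj] TB]]] := E1P G L B U Z BZ Umono UL clq.
- by move=> i ir; have := Ubig i ir; lia.
- left; exists (fun i => take_set t (T i)); split.
    move=> i ir; have [TiU Ti] := TU i ir; split.
      exact: subset_trans (take_set_sub _ _) TiU.
    by rewrite card_take_set // Ti leq_pmull.
  move=> i k x y ik kr /(subsetP (take_set_sub _ _)) xT.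
  by move=> /(subsetP (take_set_sub _ _)); apply: Tadj xT.
pose bad i := [set x in L | #|T i :&: nbhd x| < t].
pose Y := U j :\: \bigcup_(i < j) bad i.
have Ybig : (2 ^ (j * (p * t)) * 2) * (r * t) < #|Y|.
  have badZ : #|\bigcup_(i < j) bad i| <= j * Z.
    apply: card_bigcup_leq => i ij; have [_ Ti] := TU i ij.
    by apply: few_low_degree p0 Ti _ => v /(subsetP (TB i ij)); apply: BZ.
  have := Ubig j jr; have := subset_leq_card (subsetIr (U j) (\bigcup_(i < j) bad i)).
  by rewrite /Y cardsD; lia.
pose W := \bigcup_(i < j) T i.
have TW i : i < j -> T i \subset W.
  by move=> ij; apply: (bigcup_sup (Ordinal ij)).
have Wsz : #|W| <= j * (p * t).
  by apply: card_bigcup_leq => i ij; case: (TU i ij) => _ ->.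
have [||[S b] _ Fbig] := @pigeonhole _ _ (fun x => (W :&: nbhd x, x \in B)) Y
    (setX (powerset W) [set: bool]) (r * t).
- by move=> x _; rewrite !inE subsetIl.
- apply: leq_ltn_trans Ybig; rewrite cardsX card_powerset cardsT card_bool.
  by rewrite leq_mul2r leq_mul2r /= leq_exp2l // Wsz !orbT.
set F := [set x in Y | _] in Fbig.
have FY x : x \in F -> [/\ x \in U j, W :&: nbhd x = S & (x \in B) = b].
  by rewrite inE => /andP[]; rewrite inE => /andP[_ ->] /eqP[-> ->].
have Fadj i x y : i < j -> x \in F -> y \in T i :&: S -> adj y x.
  move=> ij xF; have [_ <- _] := FY x xF.
  by rewrite !inE adj_sym => /andP[_ /andP[]].
have TS i : i < j -> t <= #|T i :&: S|.
  move=> ij; have /card_gt0P[x xF] : 0 < #|F| by apply: leq_ltn_trans Fbig.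
  have [xU xS _] := FY x xF; rewrite -xS setIA (setIidPl (TW i ij)).
  move: xF; rewrite inE => /andP[]; rewrite inE => /andP[xbad _] _.
  rewrite leqNgt; apply: contra xbad => lt; apply/bigcupP; exists (Ordinal ij) => //.
  by rewrite inE lt (subsetP (UL j jr)).
have old i x : x \in take_set t (T i :&: S) -> x \in T i :&: S.
  exact: (subsetP (take_set_sub _ _)).
have oldT i x : x \in take_set t (T i :&: S) -> x \in T i.
  by move=> /old; rewrite inE => /andP[].
have oldU i : i < j ->
    take_set t (T i :&: S) \subset U i /\ #|take_set t (T i :&: S)| = t.
  move=> ij; have [TiU _] := TU i ij; split; last exact: card_take_set (TS i ij).
  by apply/subsetP => x /oldT; apply: (subsetP TiU).
(* Inside [B] the group provides class [j]. Outside [B] it is a clique; it is cut into all classes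
   from [j] on, and lies in the later sets [U i] by monotonicity. *)
case: b @F FY Fbig Fadj TS => F FY Fbig Fadj TS.
- right; exists (fun i => if i < j then take_set t (T i :&: S) else take_set t F).
  have subF x : x \in take_set t F -> x \in F by apply: (subsetP (take_set_sub _ _)).
  split; first split.
  + move=> i; rewrite ltnS => ij; case: ltnP => [/oldU //|ji].
    have -> : i = j by apply/eqP; rewrite eqn_leq ij.
    split; first by apply/subsetP => x /subF /FY[].
    by rewrite card_take_set // (leq_trans _ (ltnW Fbig)) // leq_pmull //; lia.
  + move=> i k x y ik kj; have ij : i < j by lia.
    rewrite ij; case: (ltnP k j) => [kj' /oldT xT /oldT yT|jk /old xT /subF yF].
      exact: Tadj xT yT.
    exact: Fadj yF xT.
  + move=> i; rewrite ltnS => ij; case: ltnP => [ij'|_]; apply/subsetP => x.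
      by move=> /oldT; apply: (subsetP (TB i ij')).
    by move=> /subF /FY[_ _ ->].
- left; have [|P [PF Pdisj]] := @split_parts _ F r t; first exact: ltnW.
  exists (fun i => if i < j then take_set t (T i :&: S) else P i); split.
    move=> i ir; case: ltnP => [/oldU //|ji]; have [/subsetP PiF Pi] := PF i ir.
    split=> //; apply/subsetP => x /PiF /FY[xU _ _].
    exact: (subsetP (Umono j i ji)).
  move=> i k x y ik kr; case: (ltnP i j) => [ij|ji].
    case: (ltnP k j) => [kj /oldT xT /oldT yT|jk /old xT yP]; first exact: Tadj xT yT.
    by apply: Fadj xT => //; have [/subsetP->] := PF k kr.
  rewrite ltnNge (leq_trans ji (ltnW ik)) /= => xP yP.
  have ir : i < r by lia.
  have [/subsetP/(_ x xP)/FY[xU _ xB] _] := PF i ir.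
  have [/subsetP/(_ y yP)/FY[yU _ yB] _] := PF k kr.
  by apply: (clq j) => //; [rewrite xB | rewrite yB | apply: Pdisj xP yP].
Qed.

Lemma complete_parts_exist (p r t : nat) : 0 < p ->
  exists E, forall (G : sgraph) (L B : {set G}) (U : nat -> {set G}) (Z : nat),
    (forall v, v \in B -> p * #|L :\: nbhd v| <= p.-1 * Z) ->
    (forall i k, i <= k -> U i \subset U k) ->
    (forall i, i < r -> U i \subset L) ->
    (forall i x y, i < r -> x \in U i -> y \in U i ->
       x \notin B -> y \notin B -> x != y -> adj x y) ->
    (forall i, i < r -> i * Z + E <= #|U i|) ->
  exists T, complete_parts U T r t.
Proof.
move=> p0; have [E EP] := complete_parts_exist_upto t p0 (leqnn r).
exists E => G L B U Z h1 h2 h3 h4 h5.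
by have [//|[T [TP _]]] := EP G L B U Z h1 h2 h3 h4 h5; exists T.
Qed.

(** The rank of [u] in [H] serves as its position in class [c u], so vertices of equal colour do not
    collide; vertices of different colours get adjacent, hence distinct, images. *)
Lemma embed_complete_parts (H G : sgraph) (U T : nat -> {set G}) r
    (c : H -> nat) :
  complete_parts U T r #|H| -> (forall u, c u < r) ->
  (forall u v, adj u v -> c u != c v) ->
  exists f : {ffun H -> G}, embedding f /\ forall u, f u \in U (c u).
Proof.
move=> [TU Tadj] cr cP.
(* [nth] needs a default vertex; if [G] is empty, so is [H]. *)
have [x0|noG] := pickP G; last first.
  have noH (u : H) : False.
    have [_ Tu] := TU (c u) (cr u).
    have : 0 < #|T (c u)| by rewrite Tu; apply/card_gt0P; exists u.
    by case/card_gt0P => x _; have := noG x.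
  exists (finfun (fun u => match noH u with end)).
  by split; [split|] => u; case: (noH u).
pose f u := nth x0 (enum (T (c u))) (enum_rank u).
have rk (u : H) v : enum_rank u < size (enum (T (c v))).
  by rewrite -cardE; case: (TU (c v) (cr v)) => _ ->; apply: ltn_ord.
have fT u : f u \in T (c u) by rewrite -mem_enum mem_nth.
have fadj u v : c u != c v -> adj (f u) (f v).
  rewrite neq_ltn => /orP[] lt; first exact: Tadj lt _ (fT u) (fT v).
  by rewrite adj_sym; apply: Tadj lt _ (fT v) (fT u).
exists (finfun f); split=> [|u]; last first.
  by rewrite ffunE; case: (TU (c u) (cr u)) => /subsetP->.
split=> u v; rewrite !ffunE; last by move=> /cP; apply: fadj.
have [cuv|/fadj] := eqVneq (c u) (c v); last by move=> + eq; rewrite eq adj_irr.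
rewrite /f cuv => /eqP; rewrite nth_uniq ?enum_uniq; [|exact: rk|exact: rk|by []].
by move=> /eqP /val_inj /enum_rank_inj.
Qed.

Local Open Scope ring_scope.

(** * Cheap copies *)

Lemma sum_rotation (V : nmodType) (q : nat -> V) (k i : nat) : (0 < k)%N ->
  \sum_(s < k) q ((i + s) %% k)%N = \sum_(j < k) q j.
Proof.
case: k => // k _; rewrite [RHS](reindex_inj (addrI (inZp i : 'I_k.+1))) /=.
by apply: eq_bigr => s _; rewrite modnDml.
Qed.

Lemma exists_le_average (R : realFieldType) (k : nat) (F : 'I_k -> R) (M : R) :
  (0 < k)%N -> \sum_i F i <= M -> exists i, k%:R * F i <= M.
Proof.
move=> k0 FM; apply/existsP; rewrite -[[exists i, _]]negbK negb_exists.
apply/negP => /forallP big; have : \sum_(i < k) M < \sum_(i < k) k%:R * F i.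
  apply: ltr_sum => [|i _]; last by rewrite ltNge big.
  by apply/hasP; exists (Ordinal k0); rewrite ?mem_index_enum.
rewrite sumr_const card_ord -mulr_sumr -[M *+ k]mulr_natl ltr_pM2l ?ltr0n //.
by rewrite ltNge FM.
Qed.

(** Colour [k] will be that of the smallest class of [H], which always goes to the heaviest class;
    only the colours below [k] are shifted cyclically. *)
Definition rotate (k s i : nat) : nat := if (i < k)%N then ((i + s) %% k)%N else i.

Lemma rotate_inj k s i i' :
  (0 < k)%N -> rotate k s i = rotate k s i' -> i = i'.
Proof.
move=> k0; rewrite /rotate; case: ltnP => ik; case: ltnP => i'k //.
- by move/eqP; rewrite eqn_modDr !modn_small // => /eqP.
- by have := ltn_pmod (i + s) k0; lia.
- by have := ltn_pmod (i' + s) k0; lia.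
Qed.

(** Over the [k] rotations, a vertex of colour below [k] meets every [q j] with j < k exactly once,
    while a vertex of colour [k] always pays [q k]. Some rotation does no worse than the average. *)
Lemma rotate_average (R : realFieldType) (T : finType) (c : T -> nat) (k : nat)
    (q : nat -> R) : (0 < k)%N -> (forall u, (c u <= k)%N) ->
  exists s, k%:R * \sum_u q (rotate k s (c u)) <=
    (#|T|%:R - #|[set u | c u == k]|%:R) * (\sum_(j < k) q j)
      + k%:R * #|[set u | c u == k]|%:R * q k.
Proof.
move=> k0 ck; set S := [set u | _].
have [s le_s] :=
  @exists_le_average _ k (fun s => \sum_u q (rotate k s (c u))) _ k0 (lexx _).
exists s; apply: le_trans le_s _; rewrite exchange_big /=.
rewrite (bigID (mem S)) /= addrC lerD //.
  rewrite (eq_bigr (fun=> \sum_(j < k) q j)) => [|u]; last first.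
    rewrite inE => cu; have ltu : (c u < k)%N by rewrite ltn_neqAle cu ck.
    rewrite -(sum_rotation q (c u) k0); apply: eq_bigr => j _.
    by rewrite /rotate ltu.
  rewrite sumr_const -[_ *+ _]mulr_natl.
  rewrite (_ : #|[pred u | u \notin S]| = #|~: S|); last first.
    by apply: eq_card => u; rewrite !inE.
  by rewrite cardsCs setCK natrB ?max_card.
rewrite (eq_bigr (fun=> k%:R * q k)) => [|u].
  by rewrite sumr_const -[_ *+ _]mulr_natl mulrCA mulrA.
rewrite inE => /eqP->; rewrite /rotate ltnn sumr_const card_ord.
by rewrite -[_ *+ _]mulr_natl.
Qed.

Lemma block_sum_ge (R : realFieldType) (a : nat -> R) (m n n' : nat) :
  (forall i j, (i <= j < m)%N -> a i <= a j) -> (0 < n <= n')%N -> (n' <= m)%N ->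
  (n' - n)%:R * a n.-1 <= \sum_(n <= i < n') a i.
Proof.
move=> amono /andP[n0 nn'] n'm; rewrite mulr_natl -sumr_const_nat.
by apply: ler_sum_nat => i /andP[ni iN]; apply: amono; lia.
Qed.

(** Every entry of a block of length [Z], and of the final remainder, is at least the entry just
    before that block; the first [k0] entries are dropped, being nonnegative. *)
Lemma blocks_sum_le (R : realFieldType) (a : nat -> R) (m k0 k Z : nat) :
  (forall i j, (i <= j < m)%N -> a i <= a j) -> (forall i, (i < m)%N -> 0 <= a i) ->
  (0 < k0)%N -> (k0 + k * Z <= m)%N ->
  Z%:R * \sum_(j < k) a (k0 + j * Z).-1 + (m - (k0 + k * Z))%:R * a (k0 + k * Z).-1
    <= \sum_(0 <= i < m) a i.
Proof.
move=> amono a0 k00 kZm.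
rewrite (big_cat_nat (n := k0 + k * Z)) //= lerD //; last first.
  by apply: block_sum_ge amono _ _; lia.
elim: k kZm => [|k IH] kZm.
  rewrite big_ord0 mulr0 big_nat_cond; apply: sumr_ge0 => i; rewrite andbT => /andP[_ ik].
  by apply: a0; lia.
rewrite big_ord_recr /= mulrDr (big_cat_nat (n := k0 + k * Z)) //=; last lia.
rewrite lerD //; first by apply: IH; move: kZm; rewrite mulSn; lia.
have := @block_sum_ge _ a m (k0 + k * Z) (k0 + k.+1 * Z) amono.
by rewrite mulSn (_ : (k0 + (Z + k * Z) - (k0 + k * Z)) = Z)%N; [apply; lia | lia].
Qed.

(* The vertices of [X] carry weight but may not be used; the error term pays for
   them and for the constantly many vertices spent on pigeonholing. *)
Lemma cheap_copy (R : realType) (H : sgraph) (c : H -> nat) (k p : nat) (theta : R) :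
  let b := #|H| in let sg := #|[set u | c u == k]| in
  (0 < k)%N -> (0 < p)%N -> (0 < sg)%N -> 0 <= theta <= 1 ->
  k%:R * (b%:R * theta) = b%:R - sg%:R ->
  (forall u, (c u <= k)%N) -> (forall u v, adj u v -> c u != c v) ->
  exists E : nat, forall (G : sgraph) (L X : {set G}) (w : G -> R) (W : R),
    (forall x y, x \in L :\: X -> y \in L :\: X -> x != y -> ~~ adj x y ->
       #|L :\: nbhd x|%:R + #|L :\: nbhd y|%:R <= 2 * (theta - p%:R^-1) * #|L|%:R) ->
    (forall x, x \in L -> 0 <= w x <= W) ->
    (b * (#|X| + E) <= #|L|)%N ->
  exists f : {ffun H -> G}, embedding f /\ (forall u, f u \in L :\: X) /\
    (\sum_u w (f u)) * #|L|%:R <=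
      b%:R * (\sum_(x in L) w x + W * (#|X| + E)%:R).
Proof.
move=> b sg k0 p0 sg0 /andP[th0 th1] thE ck cP.
have [E0 E0P] := complete_parts_exist k.+1 b p0.
(* [E0] pays for the pigeonholing, 1 makes [k0'] positive so that it has a predecessor, and [k] pays
   for rounding up [theta * m] in [k] blocks. *)
exists (E0 + 1 + k)%N => G L X w W ore w0W bX.
set m := #|L| in ore bX *.
have sgb : (sg <= b)%N by apply: max_card.
have b0 : (0 < b)%N by apply: leq_trans sgb.
have m0 : (0 < m)%N by apply: leq_trans bX; rewrite muln_gt0 b0; lia.
have /card_gt0P[x0 x0L] := m0.
pose s := sort (fun x y => w x <= w y) (enum L).
have sz : size s = m by rewrite size_sort -cardE.
have smem x : (x \in s) = (x \in L) by rewrite mem_sort mem_enum.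
have suniq : uniq s by rewrite sort_uniq enum_uniq.
pose a i := w (nth x0 s i).
have ssort : sorted (fun x y => w x <= w y) s.
  by apply: sort_sorted => x y; apply: le_total.
have amono i j : (i <= j < m)%N -> a i <= a j.
  move=> /andP[ij jm]; apply: (sorted_leq_nth _ _ x0 ssort) => //.
  - by move=> y x z; apply: le_trans.
  - by rewrite inE sz; lia.
  - by rewrite inE sz.
have aL i : (i < m)%N -> 0 <= a i <= W.
  by move=> im; apply: w0W; rewrite -smem mem_nth ?sz.
have sumL : \sum_(x in L) w x = \sum_(0 <= i < m) a i.
  rewrite -big_enum /= (perm_big s) /= ?(big_nth x0) ?sz //.
  by rewrite perm_sym perm_sort.
pose Z := (Num.truncn (theta * m%:R)).+1.
have /andP[Zlo Zhi] : theta * m%:R <= Z%:R <= theta * m%:R + 1.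
  have /andP[h1 h2] := truncn_itv (mulr_ge0 th0 (ler0n R m)).
  by rewrite /Z (ltW h2) -natr1 lerD2r.
pose k0' := (#|X| + E0 + 1)%N.
have bXR : b%:R * (#|X| + (E0 + 1 + k))%:R <= m%:R :> R by rewrite -natrM ler_nat.
(* The [k] blocks take about (1 - sg/b) m positions; as sg >= 1, at least m/b positions remain for
   [k0'] and the rounding. *)
have kZ : (k0' + k * Z <= m)%N.
  have b1 : 0 < b%:R :> R by rewrite ltr0n.
  have sg1 : 1 <= sg%:R :> R by rewrite ler1n.
  rewrite -(ler_nat R) -(ler_pM2l b1) natrD natrM.
  have : b%:R * (k%:R * Z%:R) <= b%:R * (k%:R * (theta * m%:R + 1)) :> R.
    by rewrite !ler_pM2l // ltr0n.
  have : m%:R * 1 <= m%:R * sg%:R :> R by rewrite ler_wpM2l.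
  have : b%:R * (k%:R * (theta * m%:R + 1)) = (b%:R - sg%:R) * m%:R + b%:R * k%:R.
    by rewrite -thE; ring.
  have := bXR; rewrite /k0' !natrD; lra.
(* The lightest vertices up to position k0' + j Z, without [X]; [B] collects the vertices of small
   codegree. *)
pose U j := [set x in take (k0' + j * Z) s] :\: X.
pose B := [set v : G | p * #|L :\: nbhd v| <= p.-1 * Z]%N.
have jk j : (j < k.+1)%N -> (k0' + j * Z <= m)%N.
  rewrite ltnS => jk; apply: leq_trans kZ.
  by rewrite leq_add2l leq_mul2r jk orbT.
have UL i : U i \subset L :\: X.
  by apply: setSD; apply/subsetP => x; rewrite inE => /mem_take; rewrite smem.
have [|||||T TP] := E0P G L B U Z.
- by move=> v; rewrite inE.
- move=> i j ij; apply: setSD; apply/subsetP => x; rewrite !inE.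
  rewrite -(@take_takel _ (k0' + i * Z) (k0' + j * Z) s); first exact: mem_take.
  by rewrite leq_add2l leq_mul2r ij orbT.
- by move=> i _; apply: subset_trans (UL i) (subsetDl _ _).
(* Outside [B] codegrees exceed (1 - 1/p) Z >= (theta - 1/p) m, by theta <= 1; two such vertices
   that are non-adjacent would contradict [ore]. *)
- move=> i x y _ /(subsetP (UL i)) xL /(subsetP (UL i)) yL xB yB xy.
  apply: contraTT isT => nxy.
  have := ore x y xL yL xy nxy; move: xB yB; rewrite !inE -!ltnNge.
  rewrite -!(ltr_nat R) !natrM.
  have -> : p.-1%:R = p%:R - 1 :> R by rewrite -subn1 natrB.
  set cx := #|_|%:R; set cy := #|_|%:R; move=> hx hy.
  have p1 : 1 <= p%:R :> R by rewrite ler1n.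
  rewrite -(ler_pM2l (lt_le_trans ltr01 p1)).
  have -> : p%:R * (2 * (theta - p%:R^-1) * m%:R) =
    2 * (p%:R * theta - 1) * m%:R :> R by field; lra.
  have : 0 <= (p%:R - 1) * (Z%:R - theta * m%:R) :> R by rewrite mulr_ge0; lra.
  have : 0 <= m%:R * (1 - theta) :> R by rewrite mulr_ge0 ?ler0n; lra.
  lra.
- move=> i ik; rewrite /U cardsD cardsE.
  have -> : #|take (k0' + i * Z) s| = (k0' + i * Z)%N.
    by rewrite (card_uniqP _) ?take_uniq // size_takel // sz jk.
  have := subset_leq_card (subsetIr [set x in take (k0' + i * Z) s] X).
  by rewrite /k0'; lia.
pose q j := a (k0' + j * Z).-1.
have Uq j x : (j < k.+1)%N -> x \in U j -> w x <= q j.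
  move=> /jk jm; rewrite !inE => /andP[_ xt].
  have xs := mem_take xt.
  have ix : (index x s < k0' + j * Z)%N by apply: index_ltn.
  rewrite -[x in w x](nth_index x0 xs); apply: amono; rewrite /k0' in ix jm *; lia.
have [r rP] := rotate_average q k0 ck.
have rk i : (i <= k)%N -> (rotate k r i < k.+1)%N.
  by rewrite /rotate ltnS; case: ifP => // _ _; apply/ltnW/ltn_pmod.
have [|u v /cP cuv|f [femb fU]] :=
    @embed_complete_parts H G U T k.+1 (fun u => rotate k r (c u)) TP.
- by move=> u; apply: rk.
- by apply: contraNneq cuv => /(rotate_inj k0) ->.
exists f; split=> //; split=> [u|]; first exact: (subsetP (UL _)) (fU u).
have cost : \sum_u w (f u) <= \sum_u q (rotate k r (c u)).
  by apply: ler_sum => u _; apply: Uq (fU u); apply: rk.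
have blocks : Z%:R * \sum_(j < k) q j + (m - (k0' + k * Z))%:R * q k <= \sum_(x in L) w x.
  have a0 i (im : (i < m)%N) : 0 <= a i by case/andP: (aL i im).
  have k0'_gt0 : (0 < k0')%N by rewrite /k0' addn1.
  by rewrite sumL; apply: (blocks_sum_le amono a0 k0'_gt0 kZ).
have pred_ltm n : (0 < n)%N -> (n <= m)%N -> (n.-1 < m)%N by case: n.
have k0j_gt0 j : (0 < k0' + j * Z)%N by rewrite /k0' addn1.
have kR : 0 < k%:R :> R by rewrite ltr0n.
rewrite -(ler_pM2l kR); set S := \sum_(j < k) q j in rP blocks.
have S0 : 0 <= S.
  apply: sumr_ge0 => j _.
  by have /andP[] := aL _ (pred_ltm _ (k0j_gt0 j) (jk j (leqW (ltn_ord j)))).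
have /andP[q0 qW] := aL _ (pred_ltm _ (k0j_gt0 k) kZ).
rewrite -/(q k) in q0 qW.
rewrite natrB // in blocks.
have step1 : k%:R * ((\sum_u w (f u)) * m%:R) <=
    k%:R * (b%:R * theta * m%:R * S + sg%:R * m%:R * q k).
  rewrite mulrA; apply: le_trans (_ : (k%:R * (\sum_u q (rotate k r (c u)))) * m%:R <= _).
    by rewrite ler_wpM2r // ler_wpM2l // ltW.
  apply: le_trans (_ : ((b%:R - sg%:R) * S + k%:R * sg%:R * q k) * m%:R <= _).
    by rewrite ler_wpM2r.
  by rewrite -thE; lra.
apply: le_trans step1 _; rewrite ler_pM2l //.
have bR : 0 < b%:R :> R by rewrite ltr0n.
have step2 : b%:R * theta * m%:R * S <= b%:R * (Z%:R * S).
  by rewrite -!mulrA ler_pM2l // mulrA ler_wpM2r.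
have : b%:R * (Z%:R * S) <= b%:R * (\sum_(x in L) w x - (m%:R - (k0' + k * Z)%:R) * q k).
  by rewrite ler_pM2l //; lra.
(* The leftover coefficient of [q k] is at most b (|X| + E) by [thE], and q k <= W turns it into the
   error term. *)
have : q k * (sg%:R * m%:R - b%:R * (m%:R - (k0' + k * Z)%:R)) <= W * (b%:R * (#|X| + (E0 + 1 + k))%:R).
  apply: le_trans (_ : q k * (b%:R * (#|X| + (E0 + 1 + k))%:R) <= _).
    rewrite ler_wpM2l // natrD natrM.
    have : b%:R * (k%:R * Z%:R) <= b%:R * (k%:R * (theta * m%:R + 1)) :> R.
      by rewrite !ler_pM2l.
    have : b%:R * (k%:R * (theta * m%:R + 1)) = (b%:R - sg%:R) * m%:R + b%:R * k%:R.
      by rewrite -thE; ring.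
    by rewrite /k0' !natrD; lra.
  by rewrite ler_wpM2r // mulr_ge0.
lra.
Qed.

(** * The drift of the relative degrees *)

Definition density (R : realType) (G : sgraph) (L : {set G}) (x : G) : R :=
  #|L :&: nbhd x|%:R / #|L|%:R.

Definition drift (R : realType) (G : sgraph) (L : {set G}) (x : G) : R :=
  density R L x - density R [set: G] x.

(** Second moment of the drift over all of [G], including removed vertices. A bound of s^2 |G| with
    small s keeps most relative degrees nearly unchanged. *)
Definition potential (R : realType) (G : sgraph) (L : {set G}) : R :=
  \sum_x drift R L x ^+ 2.

Lemma density_setT (R : realType) (G : sgraph) (x : G) :
  density R [set: G] x = (degree x)%:R / #|G|%:R.
Proof. by rewrite /density setTI cardsT. Qed.

Lemma potential_setT (R : realType) (G : sgraph) : potential R [set: G] = 0.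
Proof. by apply: big1 => x _; rewrite /drift subrr expr0n. Qed.

(* The cross term of the squares is linear in the removed set [e], and so can be
   made small by the choice of [e]. *)
Lemma potential_setD (R : realType) (G : sgraph) (L e : {set G}) :
  e \subset L -> (#|e| < #|L|)%N ->
  potential R (L :\: e) <= potential R L
    + 2 / (#|L|%:R - #|e|%:R) *
        (\sum_x drift R L x * (#|e|%:R * density R L x - #|e :&: nbhd x|%:R))
    + #|G|%:R * (#|e|%:R / (#|L|%:R - #|e|%:R)) ^+ 2.
Proof.
move=> eL ltL; set b := #|e|%:R : R; set m := #|L|%:R : R.
have bm : 0 < m - b by rewrite subr_gt0 ltr_nat.
have b0 : 0 <= b by apply: ler0n.
have -> : #|G|%:R * (b / (m - b)) ^+ 2 = \sum_(x : G) (b / (m - b)) ^+ 2.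
  by rewrite sumr_const mulr_natl.
rewrite mulr_sumr -!big_split /=; apply: ler_sum => x _.
set a := density R L x; set kx := #|e :&: nbhd x|%:R : R.
have dens : density R (L :\: e) x = a + (b * a - kx) / (m - b).
  rewrite /density cardsD (setIidPr eL) natrB ?subset_leq_card // -/m -/b.
  have -> : (L :\: e) :&: nbhd x = (L :&: nbhd x) :\: (e :&: nbhd x).
    by apply/setP => y; rewrite !inE; case: (y \in e); case: adj; rewrite ?andbF ?andbT.
  rewrite cardsD; have -> : L :&: nbhd x :&: (e :&: nbhd x) = e :&: nbhd x.
    by rewrite setIACA setIid (setIidPr eL).
  rewrite natrB; last by rewrite subset_leq_card // setSI.
  rewrite /a /density -/m -/kx; field; lra.
have dr : drift R (L :\: e) x = drift R L x + (b * a - kx) / (m - b).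
  by rewrite /drift dens /a; ring.
rewrite dr sqrrD.
have -> : drift R L x * ((b * a - kx) / (m - b)) *+ 2 =
    2 / (m - b) * (drift R L x * (b * a - kx)).
  by rewrite -mulr_natl; field; lra.
(* It remains to see that |b a - kx| <= b, which holds as both b a and kx lie between 0 and b. *)
rewrite lerD2l !expr_div_n ler_pM2r ?invr_gt0 ?exprn_gt0 //.
have a0 : 0 <= a by rewrite divr_ge0 ?ler0n.
have a1 : a <= 1.
  by rewrite ler_pdivrMr ?mul1r ?ler_nat ?subset_leq_card ?subsetIl //; rewrite -/m; lra.
have k0 : 0 <= kx by apply: ler0n.
have kb : kx <= b by rewrite ler_nat subset_leq_card ?subsetIl.
have ba : b * a <= b by rewrite ler_piMr.
have ba0 : 0 <= b * a by rewrite mulr_ge0.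
by rewrite -subr_ge0 subr_sqr mulr_ge0 //; lra.
Qed.

(** Exchange of summation, turning the cross term of the potential into a sum of weights over the
    vertices of the copy. *)
Lemma sum_nbhd_embedding (R : realType) (H G : sgraph) (f : {ffun H -> G})
    (F : G -> R) : injective f ->
  \sum_u \sum_(x in nbhd (f u)) F x = \sum_x F x * #|copy_vertices f :&: nbhd x|%:R.
Proof.
move=> finj; rewrite (exchange_big_dep xpredT) //=; apply: eq_bigr => x _.
rewrite sumr_const -[LHS]mulr_natr; congr (_ * _%:R).
rewrite -(card_imset _ finj); apply: eq_card => y.
apply/imsetP/setIP => [[u]|[/imsetP[u _ ->]]].
  move=> xu ->; have {}xu : x \in nbhd (f u) by [].
  by rewrite in_nbhd adj_sym -in_nbhd xu imset_f.
by rewrite in_nbhd adj_sym -in_nbhd => xu; exists u.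
Qed.

Lemma card_copy_vertices (H G : sgraph) (f : {ffun H -> G}) :
  injective f -> #|copy_vertices f| = #|H|.
Proof. by move=> finj; rewrite card_imset // cardsT. Qed.

(** The cross term compares the total weight of the copy with b times the average over [L], for the
    weight that sums the drifts over a neighbourhood, with reversed sign. [cheap_copy] bounds
    exactly this difference. *)
Lemma potential_removal (R : realType) (H : sgraph) (c : H -> nat) (k p : nat)
    (theta : R) :
  let b := #|H| in let sg := #|[set u | c u == k]| in
  (0 < k)%N -> (0 < p)%N -> (0 < sg)%N -> 0 <= theta <= 1 ->
  k%:R * (b%:R * theta) = b%:R - sg%:R ->
  (forall u, (c u <= k)%N) -> (forall u v, adj u v -> c u != c v) ->
  exists E : nat, forall (G : sgraph) (L X : {set G}),
    (forall x y, x \in L :\: X -> y \in L :\: X -> x != y -> ~~ adj x y ->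
       #|L :\: nbhd x|%:R + #|L :\: nbhd y|%:R <= 2 * (theta - p%:R^-1) * #|L|%:R) ->
    (b * (#|X| + E) <= #|L|)%N ->
  exists f : {ffun H -> G}, embedding f /\ copy_vertices f \subset L /\
    \sum_x drift R L x * (b%:R * density R L x - #|copy_vertices f :&: nbhd x|%:R)
      <= 2 * b%:R * (\sum_x `|drift R L x|) * (#|X| + E)%:R / #|L|%:R.
Proof.
move=> b sg k0 p0 sg0 th thE ck cP.
have [E EP] := cheap_copy k0 p0 sg0 th thE ck cP.
(* The additional 1 forces [L] to be nonempty, as the division by |L| requires. *)
exists E.+1 => G L X ore bX.
(* [S] makes the weight [w] below nonnegative without changing its optimizers. *)
set S := \sum_x _.
have subS v : `|\sum_(x in nbhd v) drift R L x| <= S.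
  apply: le_trans (ler_norm_sum _ _ _) _; rewrite /S [leRHS](bigID (mem (nbhd v))) /=.
  by rewrite lerDl sumr_ge0.
pose w (v : G) := S - \sum_(x in nbhd v) drift R L x.
have w0W x : x \in L -> 0 <= w x <= 2 * S.
  by move=> _; have := subS x; rewrite ler_norml /w => /andP[]; lra.
have [|f [femb [fL fcost]]] := EP G L X w (2 * S) ore w0W.
  by apply: leq_trans bX; rewrite leq_mul2l leq_add2l leqnSn orbT.
exists f; split=> //; split.
  by apply/subsetP => _ /imsetP[u _ ->]; have := fL u; rewrite inE => /andP[].
have b0 : (0 < b)%N by apply: leq_trans sg0 (max_card _).
have m0 : 0 < #|L|%:R :> R.
  by rewrite ltr0n; apply: leq_trans bX; rewrite muln_gt0 b0 addnS.
rewrite ler_pdivlMr //.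
have S0 : 0 <= S by apply: sumr_ge0.
move: fcost; rewrite {1}/w sumrB sum_nbhd_embedding; last by case: femb.
rewrite sumr_const (_ : #|(_ : finType)| = b) // -[S *+ b]mulr_natl.
have -> : \sum_(x in L) w x = #|L|%:R * S - #|L|%:R * \sum_x drift R L x * density R L x.
  rewrite /w sumrB sumr_const -[S *+ _]mulr_natl; congr (_ - _).
  rewrite (exchange_big_dep xpredT) //= mulr_sumr; apply: eq_bigr => x _.
  rewrite sumr_const -[LHS]mulr_natr /density mulrCA; congr (_ * _).
  rewrite mulrC divfK ?gt_eqF //; congr _%:R; apply: eq_card => y.
  by rewrite [RHS]inE in_nbhd adj_sym -in_nbhd.
have -> : \sum_x drift R L x * (b%:R * density R L x - #|copy_vertices f :&: nbhd x|%:R)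
  = b%:R * (\sum_x drift R L x * density R L x)
    - \sum_x drift R L x * #|copy_vertices f :&: nbhd x|%:R.
  by rewrite mulr_sumr -sumrB; apply: eq_bigr => x _; ring.
set A1 := \sum_x _; set A2 := \sum_x _.
have : b%:R * (2 * S * (#|X| + E)%:R) <= b%:R * (2 * S * (#|X| + E.+1)%:R) :> R.
  by rewrite !ler_wpM2l ?ler_nat ?leq_add2l // mulr_ge0.
lra.
Qed.

(** * Removing copies one at a time *)

Lemma exists_nat_ge (R : realType) (x : R) : exists n : nat, x <= n%:R.
Proof.
by exists (Num.bound `|x|); apply: le_trans (ler_norm x) (ltW (archi_boundP _)).
Qed.

(* Both terms are at most half of the allowed increase [b * s ^+ 2]; this is
   what dictates the choice of [s]. *)
Lemma increase_bound (R : realType) (b gamma eta s n mb E Q : R) :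
  1 <= b -> 0 < gamma -> 0 < eta -> 0 < s -> 0 < n -> 0 <= E ->
  s = gamma ^+ 2 * eta ^+ 2 / (64 * b) ->
  2 * (8 * s * E + 4 * b) <= n * (eta ^+ 2 * s ^+ 2) ->
  eta * n / 2 <= mb ->
  Q <= 2 * b * (s * n) * (4 * s ^+ 2 * n / gamma ^+ 2 + E) / (eta * n) ->
  2 / mb * Q + n * (b / mb) ^+ 2 <= b * s ^+ 2.
Proof.
move=> b1 ga0 et0 s0 n0 E0 sE nE mbE.
have b0 : 0 < b by apply: lt_le_trans b1.
set Q' := _ / (eta * n) => QQ'.
have en0 : 0 < eta * n by rewrite mulr_gt0.
have mb0 : 0 < mb by apply: lt_le_trans mbE; rewrite divr_gt0.
have imb : mb^-1 <= 2 / (eta * n).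
  by rewrite -[2 / _]invrK invf_div lef_pV2 ?posrE // divr_gt0.
have Q'0 : 0 <= Q'.
  apply: divr_ge0; last exact: ltW.
  apply: mulr_ge0; first by rewrite !mulr_ge0 // ltW.
  by rewrite addr_ge0 // divr_ge0 ?exprn_ge0 ?(ltW ga0) // !mulr_ge0 ?exprn_ge0 // ltW.
have term1 : 2 / mb * Q <= 2 * (2 / (eta * n)) * Q'.
  apply: le_trans (_ : 2 / mb * Q' <= _); first by rewrite ler_pM2l // divr_gt0.
  by rewrite ler_wpM2r // ler_pM2l.
have term2 : n * (b / mb) ^+ 2 <= n * (b * (2 / (eta * n))) ^+ 2.
  rewrite ler_pM2l // lerXn2r ?nnegrE //; last by rewrite ler_pM2l.
    by rewrite divr_ge0 // ltW.
  by rewrite mulr_ge0 ?divr_ge0 // ltW.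
have err : (8 * s * E + 4 * b) * b / (eta ^+ 2 * n) <= b * s ^+ 2 / 2.
  rewrite ler_pdivrMr ?mulr_gt0 ?exprn_gt0 //.
  have := ler_wpM2l (ltW b0) nE; clear; lra.
(* The factor 64 in [s] is chosen for this equality. *)
have main : 32 * b * s ^+ 3 / (gamma ^+ 2 * eta ^+ 2) = s ^+ 2 / 2.
  by rewrite exprS {1}sE; clear - ga0 et0 b0; field; lra.
have main' : s ^+ 2 / 2 <= b * s ^+ 2 / 2.
  by rewrite ler_pM2r ?invr_gt0 // ler_peMl // sqr_ge0.
have term12 : 2 * (2 / (eta * n)) * Q' + n * (b * (2 / (eta * n))) ^+ 2 =
    32 * b * s ^+ 3 / (gamma ^+ 2 * eta ^+ 2)
      + (8 * s * E + 4 * b) * b / (eta ^+ 2 * n).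
  by rewrite /Q'; clear - ga0 et0 n0; field; rewrite !gt_eqF.
have := lerD term1 term2; rewrite term12 main => le1; apply: le_trans le1 _.
have := lerD main' err; rewrite -splitr => le2; apply: le_trans le2 _; exact: lexx.
Qed.

(** Chebyshev's inequality. *)
Lemma card_large_drift (R : realType) (G : sgraph) (L : {set G}) (t : R) :
  0 <= t -> #|[set x | t < `|drift R L x|]|%:R * t ^+ 2 <= potential R L.
Proof.
move=> t0; rewrite mulr_natl -sumr_const /potential.
set X := [set x | _]; rewrite [leRHS](bigID (mem X)) /= -[leLHS]addr0 lerD //.
  apply: ler_sum => x; rewrite inE => /ltW tx.
  by rewrite -[leRHS]real_normK ?num_real // lerXn2r ?nnegrE.
by apply: sumr_ge0 => x _; apply: sqr_ge0.
Qed.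

(** From 2 s |d| <= d^2 + s^2, summed over all vertices. *)
Lemma sum_drift_le (R : realType) (G : sgraph) (L : {set G}) (s : R) :
  0 < s -> potential R L <= s ^+ 2 * #|G|%:R ->
  \sum_x `|drift R L x| <= s * #|G|%:R.
Proof.
move=> s0 potL; have s20 : 0 < 2 * s by rewrite mulr_gt0.
rewrite -(ler_pM2l s20).
have -> : 2 * s * (s * #|G|%:R) = s ^+ 2 * #|G|%:R + \sum_(x : G) s ^+ 2.
  by rewrite sumr_const -[_ *+ #|_|]mulr_natr; ring.
apply: le_trans (lerD potL (lexx _)); rewrite -big_split mulr_sumr /=.
apply: ler_sum => x _; rewrite -[X in X + _]real_normK ?num_real //.
by rewrite -subr_ge0 (_ : _ - _ = (`|drift R L x| - s) ^+ 2) ?sqr_ge0 //; ring.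
Qed.

Lemma codegree_le_drift (R : realType) (G : sgraph) (L : {set G}) (x : G) (t : R) :
  0 < #|L|%:R :> R -> - t <= drift R L x ->
  #|L :\: nbhd x|%:R <= #|L|%:R * (1 + t - (degree x)%:R / #|G|%:R).
Proof.
rewrite /drift density_setT /density => m0; set d := _ / #|G|%:R; set m := #|L|%:R.
rewrite lerBrDr ler_pdivlMr // => h.
have : m = #|L :&: nbhd x|%:R + #|L :\: nbhd x|%:R by rewrite -natrD cardsID.
by move: h; rewrite -/m; lra.
Qed.

(** The potential may grow by s^2 per removed vertex, so its bound s^2 |G| survives all removals.
    Under this bound only few vertices, the set [X], have drift beyond gamma/2, and the others
    inherit the Ore condition in [L]. *)
Lemma controlled_removal (R : realType) (H : sgraph) (c : H -> nat) (k : nat)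
    (theta gamma eta : R) :
  let b := #|H| in let sg := #|[set u | c u == k]| in
  (0 < k)%N -> (0 < sg)%N -> 0 <= theta <= 1 ->
  k%:R * (b%:R * theta) = b%:R - sg%:R ->
  (forall u, (c u <= k)%N) -> (forall u v, adj u v -> c u != c v) ->
  0 < gamma <= 1 -> 0 < eta <= 1 ->
  exists (s : R) (n0 : nat), forall G : sgraph, (n0 <= #|G|)%N ->
    (forall x y : G, x != y -> ~~ adj x y ->
       2 * (1 - theta + gamma) * #|G|%:R <= (degree x)%:R + (degree y)%:R) ->
  forall L : {set G}, eta * #|G|%:R < #|L|%:R ->
    potential R L <= s ^+ 2 * #|G|%:R ->
  exists f : {ffun H -> G}, [/\ embedding f, copy_vertices f \subset L &
    potential R (L :\: copy_vertices f) <= potential R L + b%:R * s ^+ 2].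
Proof.
move=> b sg k0 sg0 th thE ck cP /andP[ga0 ga1] /andP[et0 et1].
have b0 : (0 < b)%N by apply: leq_trans sg0 (max_card _).
have bR : 1 <= b%:R :> R by rewrite ler1n.
have bR0 : 0 < b%:R :> R by rewrite ltr0n.
have [ga0' et0'] := (ltW ga0, ltW et0).
have [p pP] := exists_nat_ge (2 / gamma).
have p0 : (0 < p)%N.
  rewrite -(ltr_nat R); apply: lt_le_trans pP; rewrite divr_gt0 //; lra.
have pinv : p%:R^-1 <= gamma / 2.
  by rewrite -[gamma / 2]invrK invf_div lef_pV2 ?posrE ?divr_gt0 ?ltr0n.
have [E EP] := potential_removal k0 p0 sg0 th thE ck cP.
pose s := gamma ^+ 2 * eta ^+ 2 / (64 * b%:R) : R.
have s0 : 0 < s by rewrite divr_gt0 ?mulr_gt0 ?exprn_gt0 // ltr0n.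
(* [n1] serves [increase_bound]; [n2] and [n3] make b E and b at most eta n / 2. *)
have [n1 n1P] := exists_nat_ge (2 * (8 * s * E%:R + 4 * b%:R) / (eta ^+ 2 * s ^+ 2)).
have [n2 n2P] := exists_nat_ge (2 * b%:R * E%:R / eta).
have [n3 n3P] := exists_nat_ge (2 * b%:R / eta).
exists s, (n1 + n2 + n3)%N => G nG ore L etaL potL.
have [nn1 nn2 nn3] : [/\ n1 <= #|G|, n2 <= #|G| & n3 <= #|G|]%N by move: nG; clear; split; lia.
set n := #|G|%:R : R in ore etaL potL *; set m := #|L|%:R : R in etaL *.
have le_n N x : (N <= #|G|)%N -> x <= N%:R -> x <= n.
  by move=> NG /le_trans; apply; rewrite ler_nat.
have n_1 : 2 * (8 * s * E%:R + 4 * b%:R) <= n * (eta ^+ 2 * s ^+ 2).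
  by rewrite -ler_pdivrMr ?(le_n _ _ nn1 n1P) // mulr_gt0 ?exprn_gt0.
have n_2 : 2 * b%:R * E%:R <= n * eta by rewrite -ler_pdivrMr //; apply: le_n nn2 n2P.
have n_3 : 2 * b%:R <= n * eta by rewrite -ler_pdivrMr //; apply: le_n nn3 n3P.
have n_gt0 : 0 < n by apply: lt_le_trans (le_n _ _ nn3 n3P); rewrite divr_gt0 // mulr_gt0.
have m_gt0 : 0 < m by apply: lt_trans etaL; rewrite mulr_gt0.
pose X := [set x : G | gamma / 2 < `|drift R L x|].
have XP : #|X|%:R * (gamma / 2) ^+ 2 <= s ^+ 2 * n.
  by apply: le_trans potL; apply: card_large_drift; rewrite divr_ge0 // ltW.
have Xle : #|X|%:R <= 4 * s ^+ 2 * n / gamma ^+ 2.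
  by rewrite ler_pdivlMr ?exprn_gt0 //; move: XP; clear; lra.
have s2 : 4 * s ^+ 2 / gamma ^+ 2 * b%:R <= eta / 2.
  have -> : 4 * s ^+ 2 / gamma ^+ 2 * b%:R = eta / 2 * (gamma ^+ 2 * eta ^+ 3 / (512 * b%:R)).
    by rewrite /s; field; rewrite !gt_eqF.
  rewrite ler_piMr ?divr_ge0 // ler_pdivrMr ?mulr_gt0 //.
  have : gamma ^+ 2 * eta ^+ 3 <= 1 by rewrite mulr_ile1 ?exprn_ile1 ?exprn_ge0.
  by move: bR; clear; lra.
have [||f [femb [fL fcost]]] := EP G L X.
(* Of the slack 2 gamma, the two drifts consume gamma and 2/p at most gamma. *)
- move=> x y; rewrite inE => /andP[xX xL]; rewrite inE => /andP[yX yL] xy nxy.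
  have codeg z : z \notin X -> #|L :\: nbhd z|%:R <= m * (1 + gamma / 2 - (degree z)%:R / n).
    by rewrite inE -leNgt ler_norml => /andP[zX _]; apply: codegree_le_drift.
  have := codeg x xX; have := codeg y yX.
  have := ore x y xy nxy; rewrite -ler_pdivlMr // [leRHS]mulrDl => hore.
  have : m * (2 * (1 - theta + gamma)) <= m * ((degree x)%:R / n + (degree y)%:R / n).
    by rewrite ler_pM2l.
  have : m * p%:R^-1 <= m * (gamma / 2) by rewrite ler_pM2l.
  rewrite -/m; lra.
- rewrite -(ler_nat R) natrM natrD -/m mulrDr.
  have : b%:R * #|X|%:R <= b%:R * (4 * s ^+ 2 * n / gamma ^+ 2) by rewrite ler_pM2l.
  have : (4 * s ^+ 2 / gamma ^+ 2 * b%:R) * n <= eta / 2 * n by rewrite ler_pM2r.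
  have -> : b%:R * (4 * s ^+ 2 * n / gamma ^+ 2) = (4 * s ^+ 2 / gamma ^+ 2 * b%:R) * n.
    by field; rewrite gt_eqF.
  move: etaL n_2; clear; lra.
exists f; split => //.
have ecard : #|copy_vertices f| = b by apply: card_copy_vertices; case: femb.
have mb : eta * n / 2 <= m - b%:R by lra.
have mb0 : 0 < m - b%:R by apply: lt_le_trans mb; rewrite divr_gt0 // mulr_gt0.
have lt_e : (#|copy_vertices f| < #|L|)%N.
  by rewrite ecard -(ltr_nat R) -/m; lra.
have := potential_setD R fL lt_e; rewrite ecard -/m -/n.
set Q := \sum_x _ in fcost *; move=> pot; apply: le_trans pot _.
rewrite -addrA lerD2l.
set S := \sum_x `|_| in fcost.
have Sle : S <= s * n by apply: sum_drift_le.
have S0 : 0 <= S by apply: sumr_ge0.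
apply: (@increase_bound _ _ gamma eta s n _ E%:R) => //.
apply: le_trans fcost _; rewrite natrD.
apply: ler_pM.
- by rewrite !mulr_ge0 ?addr_ge0 ?ler0n.
- by rewrite invr_ge0 ltW.
- rewrite ler_pM ?mulr_ge0 ?addr_ge0 ?ler0n //; last by rewrite lerD2r.
  by rewrite ler_wpM2l // mulr_ge0 ?ler0n.
- by rewrite lef_pV2 ?posrE ?mulr_gt0 // ltW.
Qed.

(** Greedy removal: after [i] steps b i vertices are covered and the potential is at most b i s^2 <=
    s^2 |G|, so [controlled_removal] applies again unless the remainder is already small. *)
Lemma packing_with_slack (R : realType) (H : sgraph) (c : H -> nat) (k : nat)
    (theta gamma eta : R) :
  let b := #|H| in let sg := #|[set u | c u == k]| in
  (0 < k)%N -> (0 < sg)%N -> 0 <= theta <= 1 ->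
  k%:R * (b%:R * theta) = b%:R - sg%:R ->
  (forall u, (c u <= k)%N) -> (forall u v, adj u v -> c u != c v) ->
  0 < gamma <= 1 -> 0 < eta <= 1 ->
  exists n0 : nat, forall G : sgraph, (n0 <= #|G|)%N ->
    (forall x y : G, x != y -> ~~ adj x y ->
       2 * (1 - theta + gamma) * #|G|%:R <= (degree x)%:R + (degree y)%:R) ->
  exists P : {set {ffun H -> G}},
    packing P /\ #|~: covered P|%:R <= eta * #|G|%:R.
Proof.
move=> b sg k0 sg0 th thE ck cP ga et.
have [s [n0 sP]] := controlled_removal k0 sg0 th thE ck cP ga et.
have b0 : (0 < b)%N by apply: leq_trans sg0 (max_card _).
exists n0 => G nG ore; have {}sP := sP G nG ore.
have step i : (exists P : {set {ffun H -> G}},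
      packing P /\ #|~: covered P|%:R <= eta * #|G|%:R) \/
    (exists P : {set {ffun H -> G}}, [/\ packing P, #|covered P| = (b * i)%N &
      potential R (~: covered P) <= (b * i)%:R * s ^+ 2]).
  elim: i => [|i [IH|[P [[Pemb Pdisj] Pcard Ppot]]]]; [right|by left|].
    exists set0; rewrite /covered big_set0 cards0 muln0 mul0r setC0.
    by rewrite potential_setT; split=> //; split=> f; rewrite inE.
  case: (lerP #|~: covered P|%:R (eta * #|G|%:R)) => [small|big].
    by left; exists P.
  have [|f [femb fL fpot]] := sP _ big.
    apply: le_trans Ppot _; rewrite mulrC ler_wpM2l ?sqr_ge0 // ler_nat -Pcard.
    exact: max_card.
  have fcov : [disjoint copy_vertices f & covered P].
    by rewrite -[covered P]setCK -subsets_disjoint.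
  have fdisj g : g \in P -> [disjoint copy_vertices f & copy_vertices g].
    by move=> gP; apply: disjointWr fcov; apply: bigcup_sup.
  have covE : covered (f |: P) = copy_vertices f :|: covered P.
    by rewrite /covered bigcup_setU big_set1.
  have fcard : #|copy_vertices f| = b by apply: card_copy_vertices; case: femb.
  right; exists (f |: P); split.
  - split=> [g|g h]; rewrite !inE; first by case/predU1P => [->|/Pemb].
    case/predU1P => [->|gP] /predU1P[->|hP]; rewrite ?eqxx // => gh.
    + exact: fdisj.
    + by rewrite disjoint_sym fdisj.
    + exact: Pdisj.
  - rewrite covE cardsU fcard Pcard; move: fcov.
    by rewrite -setI_eq0 => /eqP->; rewrite cards0 subn0 mulnS.
  - rewrite covE setCU setIC -setDE; apply: le_trans fpot _.
    by rewrite mulnS natrD mulrDl addrC lerD2l.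
(* So many copies would cover more than |G| vertices. *)
have [//|[P [_ Pcard _]]] := step #|G|.+1.
have := max_card (covered P); rewrite Pcard => /(leq_trans _) le.
by have := le _ (leq_pmull _ b0); rewrite ltnn.
Qed.

(** * Gaining slack, and the theorem *)

Definition join_adj (G : sgraph) (m : nat) : rel (G + 'I_m) := fun x y =>
  match x, y with inl a, inl a' => adj a a' | _, _ => x != y end.

Lemma join_adj_sym (G : sgraph) (m : nat) : symmetric (@join_adj G m).
Proof. by move=> [x|i] [y|j] //=; rewrite 1?adj_sym // eq_sym. Qed.

Lemma join_adj_irr (G : sgraph) (m : nat) : irreflexive (@join_adj G m).
Proof. by move=> [x|i] /=; rewrite ?adj_irr ?eqxx. Qed.

Definition join_clique (G : sgraph) (m : nat) : sgraph :=
  SGraph (@join_adj_sym G m) (@join_adj_irr G m).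

Lemma degree_join_clique (G : sgraph) (m : nat) (x : G) :
  degree (inl x : join_clique G m) = (degree x + m)%N.
Proof.
rewrite /degree -!sum1_card big_sumType /=; congr (_ + _)%N.
  by apply: eq_bigl => y; rewrite !inE.
by rewrite (eq_bigl xpredT) ?sum1_card ?card_ord // => i; rewrite inE.
Qed.

(** Only the copies avoiding the new vertices are kept. By disjointness at most [m] copies are lost,
    each with |H| vertices. *)
Lemma packing_join_clique (H G : sgraph) (m : nat)
    (P' : {set {ffun H -> join_clique G m}}) : packing P' ->
  exists P : {set {ffun H -> G}},
    packing P /\ (#|~: covered P| <= #|~: covered P'| + m * #|H|)%N.
Proof.
move=> [P'emb P'disj].
pose lift (f : {ffun H -> G}) : {ffun H -> join_clique G m} := [ffun u => inl (f u)].
have mem_lift f x : x \in copy_vertices f -> (inl x : join_clique G m) \in copy_vertices (lift f).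
  by move=> /imsetP[u _ ->]; apply/imsetP; exists u => //; rewrite ffunE.
pose P := [set f | lift f \in P']; exists P; split.
  split=> [f|f g]; rewrite !inE => fP.
    have [finj fadj] := P'emb _ fP; split=> [u v fuv|u v /fadj].
      by apply: finj; rewrite !ffunE fuv.
    by rewrite !ffunE.
  move=> gP fg; have lfg : lift f != lift g.
    apply: contraNneq fg => /ffunP eq_fg; apply/eqP/ffunP => u.
    by have := eq_fg u; rewrite !ffunE => -[].
  have dis := P'disj _ _ fP gP lfg; apply/pred0P => x /=; apply/negP => /andP[xf xg].
  by have /pred0P/(_ (inl x)) := dis; rewrite /= !mem_lift.
pose new (f : {ffun H -> join_clique G m}) := [pick i | (inr i : join_clique G m) \in copy_vertices f].
pose Bad := [set f in P' | new f != None].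
have newP f i : new f = Some i -> (inr i : join_clique G m) \in copy_vertices f.
  by rewrite /new; case: pickP => // j jf [<-].
have Badm : (#|Bad| <= m)%N.
  rewrite -(@card_in_imset _ _ new) => [|f g]; last first.
    rewrite !inE => /andP[fP]; case fi: (new f) => [i|] // _ /andP[gP] _ /esym gi.
    apply/eqP; apply/negPn/negP => fg; have /pred0P/(_ (inr i)) := P'disj _ _ fP gP fg.
    by rewrite /= !newP.
  apply: leq_trans (_ : #|[set Some i | i : 'I_m]| <= m)%N; last first.
    by rewrite card_imset ?card_ord //; apply: Some_inj.
  apply: subset_leq_card; apply/subsetP => o /imsetP[f]; rewrite inE => /andP[_].
  by case: (new f) => // i _ ->; apply: imset_f.
have inlI : injective (inl : G -> join_clique G m) by move=> x y [].
rewrite -(card_imset _ inlI).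
apply: leq_trans (_ : #|~: covered P' :|: \bigcup_(f in Bad) copy_vertices f| <= _)%N.
  apply: subset_leq_card; apply/subsetP => _ /imsetP[x xP ->].
  rewrite !inE; case: (boolP (_ \in covered P')) => //= /bigcupP[f fP xf].
  apply/bigcupP; exists f => //; rewrite inE fP.
  apply: contraTneq xP => newN; rewrite inE negbK.
  (* [x] is only a default: [f] takes no value among the new vertices. *)
  pose g : {ffun H -> G} := [ffun u => if f u is inl a then a else x].
  have gf : lift g = f.
    apply/ffunP => u; rewrite !ffunE; case fu: (f u) => [a|i] //.
    move: newN; rewrite /new; case: pickP => // /(_ i).
    by rewrite -fu imset_f.
  apply/bigcupP; exists g; first by rewrite inE gf.
  move: xf; rewrite -gf => /imsetP[u _]; rewrite ffunE => -[->].
  exact: imset_f.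
apply: leq_trans (leq_card_setU _ _) _; rewrite leq_add2l.
apply: leq_trans (_ : \sum_(f in Bad) #|copy_vertices f| <= _)%N.
  elim/big_rec2: _ => [|f n A _ IH]; first by rewrite cards0.
  by apply: leq_trans (leq_card_setU _ _) _; rewrite leq_add2l.
apply: leq_trans (_ : #|Bad| * #|H| <= _)%N; last by rewrite leq_mul2r Badm orbT.
rewrite -sum_nat_const; apply: leq_sum => f; rewrite inE => /andP[fP _].
by rewrite card_copy_vertices //; case: (P'emb _ fP).
Qed.

(** * Optimal colourings of $H$ *)

Lemma chi_colourable (H : sgraph) : colourable H (chi H).
Proof. by rewrite /chi; case: ex_minnP. Qed.

Lemma leq_chi (H : sgraph) j : colourable H j -> (chi H <= j)%N.
Proof. by rewrite /chi; case: ex_minnP => n _; apply. Qed.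

Lemma colour_class_gt0 (H : sgraph) (c : {ffun H -> 'I_(chi H)}) i :
  (1 < chi H)%N -> proper_colouring c -> (0 < #|colour_class c i|)%N.
Proof.
move=> chi1 cP; rewrite lt0n; apply/negP => /eqP/cards0_eq class0.
have ci u : i != c u.
  apply/eqP => icu; have : u \in colour_class c i by rewrite inE icu.
  by rewrite class0 inE.
suff : (chi H <= (chi H).-1)%N by case: (chi H) chi1 => // n _; rewrite ltnn.
apply: leq_chi; have def : 'I_(chi H).-1 by apply: (@Ordinal _ 0); lia.
apply/existsP; exists [ffun u => odflt def (unlift i (c u))].
apply/forallP => u; apply/forallP => v; apply/implyP => uv; rewrite !ffunE.
have [j cu ->] := unlift_some (ci u); have [j' cv ->] := unlift_some (ci v).
have /forallP/(_ u)/forallP/(_ v)/implyP/(_ uv) := cP.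
by apply: contraNneq => /= jj'; rewrite cu cv jj'.
Qed.

(** Brings an optimal colouring into the form used above: colours are numbers and a transposition
    gives the smallest class the last colour [k]. An edge forces two nonempty classes, whence 0 <
    sigma(H) < |H|. *)
Lemma sigma_colouring (H : sgraph) : (exists u v : H, adj u v) ->
  exists (c : H -> nat) (k : nat),
    [/\ (0 < k)%N, chi H = k.+1, forall u, (c u <= k)%N,
        forall u v, adj u v -> c u != c v &
        #|[set u | c u == k]| = sigma H /\ (0 < sigma H < #|H|)%N].
Proof.
move=> [u0 [v0 uv0]]; have /existsP[c0 c0P] := chi_colourable H.
have proper (c : {ffun H -> 'I_(chi H)}) u v : proper_colouring c -> adj u v -> c u != c v.
  by move=> /forallP/(_ u)/forallP/(_ v)/implyP; apply.
have chi1 : (1 < chi H)%N.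
  have := proper c0 u0 v0 c0P uv0; case: (c0 u0) (c0 v0) => [a ai] [b bi].
  by rewrite -val_eqE /=; lia.
(* The default |H| is an upper bound for all terms, so both minima are attained. *)
have [c cP sigE] : {c : {ffun H -> 'I_(chi H)} | proper_colouring c &
    sigma H = \big[Order.min/#|H|]_(i < chi H) #|colour_class c i|}.
  apply: (@eq_bigmin _ _ _ _ c0) => // c _; exact: bigmin_le_id.
have [i _ sigEi] : {i : 'I_(chi H) | xpredT i & sigma H = #|colour_class c i|}.
  rewrite sigE; apply: (@eq_bigmin _ _ _ _ (c0 u0)) => // i _; exact: max_card.
have [k chiE] : exists k, chi H = k.+1 by exists (chi H).-1; rewrite prednK // ltnW.
have [last lastE] : exists l : 'I_(chi H), l = k :> nat.
  have klt : (k < chi H)%N by rewrite chiE.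
  by exists (Ordinal klt).
exists (fun u => tperm i last (c u) : nat), k; split=> //.
- by rewrite -ltnS -chiE.
- by move=> u; rewrite -ltnS -chiE ltn_ord.
- by move=> u v uv; apply: contraNneq (proper c u v cP uv) => /val_inj/perm_inj ->.
split.
  rewrite sigEi; apply: eq_card => u; rewrite !inE -lastE val_eqE.
  by rewrite -[X in _ == X](tpermL i) (inj_eq perm_inj).
rewrite {1}sigEi colour_class_gt0 //=.
have [j ji] : exists j : 'I_(chi H), j != i.
  have [<-|] := eqVneq (c u0) i; last by exists (c u0).
  by exists (c v0); rewrite eq_sym; apply: proper.
rewrite sigEi -(cardsC (colour_class c i)) -[ltnLHS]addn0 ltn_add2l.
apply: leq_trans (colour_class_gt0 j chi1 cP) _; apply: subset_leq_card.
by apply/subsetP => u; rewrite !inE => /eqP->.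
Qed.

(** * Reduction of the theorem to the version with slack *)

Theorem theorem4 (R : realType) (H : sgraph)
    (H_edge : exists u v : H, adj u v) (eta : R) (eta_gt0 : 0 < eta) :
  exists n0 : nat, forall G : sgraph, (n0 <= #|G|)%N ->
    (forall x y : G, x != y -> ~~ adj x y ->
       2 * (1 - 1 / chi_cr R H) * #|G|%:R <= (degree x)%:R + (degree y)%:R) ->
    exists P : {set {ffun H -> G}},
      packing P /\ #|~: covered P|%:R <= eta * #|G|%:R.
Proof.
have [c [k [k0 chiE ck cP [cls /andP[sg0 sgb]]]]] := sigma_colouring H_edge.
set b := #|H| in sgb *; set sg := sigma H in cls sg0 sgb *.
have b0 : 0 < b%:R :> R by rewrite ltr0n; apply: leq_trans sgb.
have k0R : 1 <= k%:R :> R by rewrite ler1n.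
have sgR : 0 < sg%:R :> R by rewrite ltr0n.
have sgbR : sg%:R < b%:R :> R by rewrite ltr_nat.
pose theta : R := (b%:R - sg%:R) / (k%:R * b%:R).
have kb0 : 0 < k%:R * b%:R :> R by rewrite mulr_gt0 //; lra.
have th0 : 0 < theta by rewrite divr_gt0 //; lra.
have th1 : theta <= 1.
  by rewrite ler_pdivrMr // mul1r; apply: le_trans (ler_peMl _ k0R); lra.
have thE : k%:R * (b%:R * theta) = b%:R - sg%:R.
  by rewrite /theta; field; rewrite !gt_eqF //; lra.
have chi_crE : 1 / chi_cr R H = theta.
  rewrite /chi_cr chiE -natr1 addrK -/b -/sg /theta.
  by field; rewrite !gt_eqF //; lra.
pose eta1 := Num.min eta 1.
have [eta10 eta11] : 0 < eta1 /\ eta1 <= 1.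
  by rewrite /eta1 lt_min eta_gt0 ltr01 ge_min lexx orbT.
(* About delta n universal vertices are added; the copies they spoil cost at most b delta n = eta1 n
   / 2 vertices. *)
pose delta := eta1 / (2 * b%:R).
have delta0 : 0 < delta by rewrite divr_gt0 // mulr_gt0.
have delta1 : delta <= 1.
  rewrite ler_pdivrMr ?mulr_gt0 // mul1r; apply: le_trans eta11 _.
  by have : 1 <= b%:R :> R by [rewrite ler1n -(ltr_nat R)]; lra.
pose gamma := delta * theta / 4.
have gamma0 : 0 < gamma by rewrite divr_gt0 // mulr_gt0.
have dth : delta * theta <= 1 by rewrite mulr_ile1 // ltW.
have gamma1 : gamma <= 1 by rewrite /gamma; lra.
rewrite -cls in thE sg0.
have ga : 0 < gamma <= 1 by apply/andP.
have et : 0 < eta1 / 4 <= 1 by apply/andP; split; lra.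
have th : 0 <= theta <= 1 by apply/andP; split; lra.
have [n0 n0P] := packing_with_slack k0 sg0 th thE ck cP ga et.
(* From delta n >= 2 it follows that rounding delta n down to [m] loses at most half of it. *)
have [n1 n1P] := exists_nat_ge (2 / delta).
exists (n0 + n1)%N => G nG ore; set n := #|G|%:R : R in ore *.
have nn1 : 2 <= delta * n.
  rewrite mulrC -ler_pdivrMr //; apply: le_trans n1P _.
  by rewrite ler_nat; apply: leq_trans nG; apply: leq_addl.
have n_ge0 : 0 <= n by apply: ler0n.
have dn : delta * n <= n by rewrite ler_piMl.
have [m /andP[mlo mhi]] : exists m : nat, m%:R <= delta * n < m%:R + 1.
  by exists (Num.truncn (delta * n)); rewrite natr1 truncn_itv // mulr_ge0 // ltW.
have cardG' : #|join_clique G m| = (#|G| + m)%N.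
  by rewrite card_sum card_ord.
have [||P' [P'pack P'small]] := n0P (join_clique G m).
- by rewrite cardG' (leq_trans (leq_trans (leq_addr _ _) nG)) ?leq_addr.
(* New vertices raise degree sums by 2 m but the threshold by only 2 (1 - theta) m; the surplus 2
   theta m covers the slack 2 gamma (n + m). *)
- have slack : gamma * (n + m%:R) <= theta * m%:R.
    have : gamma * (n + m%:R) <= gamma * (2 * n) by rewrite ler_pM2l //; lra.
    have : theta * (delta * n) <= theta * (2 * m%:R) by rewrite ler_pM2l //; lra.
    rewrite /gamma; lra.
  move=> [x|i] [y|j] //; rewrite ?negbK //= => xy nxy; rewrite ?(negbTE xy) // in nxy.
    have {}xy : x != y by apply: contraNneq xy => ->.
    have := ore x y xy nxy; rewrite chi_crE !degree_join_clique cardG' !natrD -/n.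
    lra.
have [P [Ppack Psmall]] := packing_join_clique P'pack.
exists P; split=> //.
have : #|~: covered P|%:R <= #|~: covered P'|%:R + m%:R * b%:R :> R.
  by rewrite -natrM -natrD ler_nat.
rewrite cardG' natrD -/n in P'small.
have mb : m%:R * b%:R <= eta1 / 2 * n.
  have : m%:R * b%:R <= delta * n * b%:R by rewrite ler_pM2r.
  by have -> : delta * n * b%:R = eta1 / 2 * n by [rewrite /delta; field; lra].
(* The vertices uncovered in the join and those of spoiled copies each number at most eta1 n / 2. *)
have : eta1 / 4 * (n + m%:R) <= eta1 / 4 * (2 * n) by rewrite ler_pM2l; lra.
have : eta1 * n <= eta * n by rewrite ler_wpM2r // /eta1 ge_min lexx.
lra.
Qed.
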